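(* Let $q\in(0,1)$ and let $W=(w_{ij})_{i,j\ge1}$ have i.i.d. entries with $\mathrm P(w_{ij}=k)=(1-q)q^k$, $k\in\mathbb N$. For $m,n\ge1$ let $G(m,n)=\max_\Pi\sum_{(i,j)\in\Pi}w_{ij}$, the maximum over monotone lattice paths $\Pi$ from $(1,1)$ to $(m,n)$ with steps $(i,j)\to(i+1,j),(i,j+1)$. Let $b,c$ be positive integers and $\lambda=(\lambda_1\ge\cdots\ge\lambda_b\ge0)$ a partition with at most $b$ parts. Then $$\mathrm P(G(b,c)=\lambda_1,\ G(b-1,c)=\lambda_2,\dots,G(1,c)=\lambda_b)=\mathrm P_{g,b,c}(\lambda)=(1-q)^{bc}\,g_\lambda(\underbrace{q,\dots,q}_{c}),$$ where $\mathrm P_{g,b,c}(\lambda)$ is the probability that a plane partition distributed according to the $g$-measure with $q_1=\cdots=q_c=q$ has shape $\lambda$.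
   Context: $\mathrm{PP}(\infty,b,c)$ is the set of plane partitions (arrays $(\pi_{ij})_{i,j\ge1}$ of nonnegative integers, finitely many nonzero, weakly decreasing along rows and columns) with at most $b$ nonzero rows and entries at most $c$; the shape of $\pi$ is the partition with parts $|\{j:\pi_{ij}>0\}|$. $\mathrm{Des}(\pi)=\{(i,j):\pi_{ij}>\pi_{i+1,j}\}$. For $q_1,\dots,q_c\in(0,1)$ the $g$-measure is $\mathrm P_{g,b,c}(\pi)=Z_{b,c}^{-1}\prod_{(i,j)\in\mathrm{Des}(\pi)}q_{\pi_{ij}}$ with normalizing constant $Z_{b,c}$. The dual Grothendieck polynomial is $g_\lambda(x_1,\dots,x_n)=\sum_T\prod_ix_i^{c_i(T)}$ over plane partitions $T$ of shape $\lambda$ with entries at most $n$, where $c_i(T)$ is the number of columns of $T$ containing $i$. *)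

(* Defs.v *)
From HB Require Import structures.
From mathcomp Require Import all_boot all_order all_algebra finmap.
From mathcomp Require Import all_classical all_reals all_analysis.

Set Implicit Arguments.
Unset Strict Implicit.
Unset Printing Implicit Defensive.

Import Order.TTheory GRing.Theory Num.Theory.

Local Open Scope classical_set_scope.
Local Open Scope ring_scope.

(* Rows, columns and parts are numbered from 0: a value [p i j] stands for
   p_{i+1,j+1}, and [la i] for lambda_{i+1}.  The entries of a plane partition,
   and hence the indices of the parameters q_k and of the variables x_k, are
   not shifted. *)

Definition card_set (T : choiceType) (A : set T) : nat := #|` fset_set A|.

Definition partition_at_most (b : nat) (la : nat -> nat) : Prop :=
  (forall i, (la i.+1 <= la i)%N) /\ (forall i, (b <= i)%N -> la i = 0%N).

Definition plane_partition (p : nat -> nat -> nat) : Prop :=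
  [/\ finite_set [set ij : nat * nat | p ij.1 ij.2 <> 0%N],
      (forall i j, (p i j.+1 <= p i j)%N) &
      (forall i j, (p i.+1 j <= p i j)%N)].

Definition pp_shape (p : nat -> nat -> nat) : nat -> nat :=
  fun i => card_set [set j : nat | (0 < p i j)%N].

Definition PP (b c : nat) : set (nat -> nat -> nat) :=
  [set p | [/\ plane_partition p,
              (forall i j, (b <= i)%N -> p i j = 0%N) &
              (forall i j, (p i j <= c)%N)]].

Definition Des (p : nat -> nat -> nat) : set (nat * nat) :=
  [set ij | (p ij.1.+1 ij.2 < p ij.1 ij.2)%N].

Definition g_weight (R : realType) (q : nat -> R) (p : nat -> nat -> nat) : R :=
  \big[*%R/1]_(ij \in Des p) q (p ij.1 ij.2).

(* The sum converges when 0 <= q_k < 1 for 1 <= k <= c. *)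
Definition g_Z (R : realType) (q : nat -> R) (b c : nat) : \bar R :=
  \esum_(p in PP b c) (g_weight q p)%:E.

Definition g_mass (R : realType) (q : nat -> R) (b c : nat)
    (p : nat -> nat -> nat) : R :=
  (fine (g_Z q b c))^-1 * g_weight q p.

Definition g_prob (R : realType) (q : nat -> R) (b c : nat)
    (A : set (nat -> nat -> nat)) : \bar R :=
  \esum_(p in PP b c `&` A) (g_mass q b c p)%:E.

(* Only meant for k >= 1: every plane partition has infinitely many columns
   containing 0. *)
Definition columns_containing (p : nat -> nat -> nat) (k : nat) : nat :=
  card_set [set j : nat | exists i, p i j = k].

Definition pp_shape_entries (la : nat -> nat) (n : nat) :
    set (nat -> nat -> nat) :=
  [set p | [/\ plane_partition p, pp_shape p = la & forall i j, (p i j <= n)%N]].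

(* The value of g_la(x_1, ..., x_n); the sum ranges over a finite set, by
   [finite_pp_shape_entries] below. *)
Definition dual_grothendieck (R : comNzRingType) (la : nat -> nat) (n : nat)
    (x : nat -> R) : R :=
  \sum_(p \in pp_shape_entries la n)
    \prod_(1 <= k < n.+1) x k ^+ columns_containing p k.

Definition lattice_step (u v : nat * nat) : bool :=
  (v == (u.1.+1, u.2)) || (v == (u.1, u.2.+1)).

Definition lattice_path (m n : nat) (s : seq (nat * nat)) : bool :=
  if s is u :: s' then
    [&& u == (0, 0)%N, path lattice_step u s' & last u s' == (m.-1, n.-1)]
  else false.

(* For m, n >= 1 the monotone paths from corner to corner of an m x n
   rectangle stay in it and have m + n - 1 vertices ([lattice_path_size] and
   [lattice_path_inside] below), so this is the maximum over all of them. *)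
Definition last_passage (w : nat -> nat -> nat) (m n : nat) : nat :=
  (\max_(s : (m + n).-1.-tuple ('I_m * 'I_n)
        | lattice_path m n [seq (val z.1, val z.2) | z <- s])
    \sum_(z <- s) w (val z.1) (val z.2))%N.

Definition mutually_independent d (T : measurableType d) d'
    (T' : measurableType d') (R : realType) (P : probability T R)
    (I : choiceType) (X : I -> {RV P >-> T'}) : Prop :=
  forall (J : {fset I}) (A : I -> set T'),
    (forall i, measurable (A i)) ->
    P (\bigcap_(i in [set` J]) (X i @^-1` A i))
      = (\prod_(i <- J) P (X i @^-1` A i))%E.

Lemma lattice_path_bound u s : path lattice_step u s ->
  all (fun v => (v.1 <= (last u s).1) && (v.2 <= (last u s).2))%N (u :: s) /\
  ((last u s).1 + (last u s).2 = u.1 + u.2 + size s)%N.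
Proof.
elim: s u => [|v s IH] u /=; first by rewrite !leqnn addn0.
case/andP=> uv /IH [/= /andP[/andP[h1 h2] ->] ->].
case/orP: uv => /eqP v_eq; rewrite v_eq /= in h1 h2 *; split;
  by rewrite ?(ltnW h1) ?(ltnW h2) ?h1 ?h2 // ?addSn ?addnS.
Qed.

Lemma lattice_path_size m n s : (0 < m)%N -> (0 < n)%N ->
  lattice_path m n s -> size s = (m + n).-1.
Proof.
case: m n => [|m] [|n] // _ _; case: s => // u s.
case/and3P=> /eqP -> /lattice_path_bound[_ lS] /eqP lE.
by rewrite lE /= in lS; rewrite addSn /= addnS lS.
Qed.

Lemma lattice_path_inside m n s : (0 < m)%N -> (0 < n)%N ->
  lattice_path m n s -> all (fun v => (v.1 < m) && (v.2 < n))%N s.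
Proof.
case: m n => [|m] [|n] // _ _; case: s => // u s.
by case/and3P=> _ /lattice_path_bound[lA _] /eqP lE; rewrite lE in lA.
Qed.

Lemma shape_gt p i j : plane_partition p -> (0 < p i j)%N -> (j < pp_shape p i)%N.
Proof.
move=> [fp prow _] pij.
have fi : finite_set [set j : nat | (0 < p i j)%N].
  apply: (sub_finite_set _ (finite_image snd fp)) => k /= pk.
  by exists (i, k) => //=; move: pk; case: (p i k).
apply: leq_card_fset_set => //.
apply: subset_card_le => k /=; rewrite ltnS => kj.
rewrite (leq_trans pij)// -(subnK kj); elim: (j - k)%N => // l IH.
by rewrite addSn (leq_trans (prow _ _)).
Qed.

Lemma shape_row_eq0 p : plane_partition p ->
  exists N, forall i, (N <= i)%N -> pp_shape p i = 0%N.
Proof.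
move=> [fp _ _]; have fi := finite_image fst fp.
exists (\max_(k <- fset_set (fst @` [set ij : nat * nat | p ij.1 ij.2 <> 0%N])) k).+1.
move=> i iN; rewrite /pp_shape /card_set.
suff -> : [set j : nat | (0 < p i j)%N] = set0 by rewrite fset_set0 cardfs0.
rewrite -subset0 => j /= pij; move: iN; rewrite ltnNge => /negP; apply.
apply: (leq_bigmax_seq (F := id)) => //.
rewrite in_fset_set// inE; exists (i, j) => //=.
by move: pij; case: (p i j).
Qed.

Lemma finite_pp_shape_entries la n : finite_set (pp_shape_entries la n).
Proof.
have [->|/set0P[p0 [pp0 sp0 _]]] := eqVneq (pp_shape_entries la n) set0.
  exact: finite_set0.
have [N la0] := shape_row_eq0 pp0; rewrite sp0 in la0.
pose M := (\max_(i < N) la i)%N.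
pose fill (f : {ffun 'I_N * 'I_M -> 'I_n.+1}) (i j : nat) : nat :=
  if (insub i, insub j) is (Some i', Some j') then f (i', j') else 0%N.
apply: (@sub_finite_set _ _ (fill @` [set: {ffun 'I_N * 'I_M -> 'I_n.+1}])).
  move=> p [pp sp pn]; exists [ffun ij => inord (p (val ij.1) (val ij.2))] => //.
  apply/funext => i; apply/funext => j; rewrite /fill.
  have p0E : (~~ (i < N)%N) || ~~ (j < M)%N -> 0%N = p i j.
    move=> ij; apply/esym/eqP; rewrite -leqn0 leqNgt; apply/negP => pij.
    have := shape_gt pp pij; rewrite sp => jla.
    have iN : (i < N)%N by rewrite ltnNge; apply/negP => /la0 l0; rewrite l0 in jla.
    move: ij; rewrite iN /= => /negP; apply; apply: leq_trans jla _.
    exact: (@leq_bigmax _ (fun i : 'I_N => la i) (Ordinal iN)).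
  case: insubP => [i' iN i'E|iN]; last by apply: p0E; rewrite iN.
  case: insubP => [j' jM j'E|jM]; last by apply: p0E; rewrite jM orbT.
  by rewrite ffunE /= i'E j'E inordK ?ltnS ?pn.
by apply: finite_image; exact: finite_finset.
Qed.

(* Main.v *)
Require Import Defs.
From HB Require Import structures.
From mathcomp Require Import all_boot all_order all_algebra finmap.
From mathcomp Require Import all_classical all_reals all_analysis.
From mathcomp Require Import zify.

(* Let a_{i,k} be the number of entries of row i of a plane partition that
   exceed k.  The columns j with p_{ij} = k+1 > p_{i+1,j} are those with
   max(a_{i+1,k}, a_{i,k+1}) <= j < a_{i,k}, so the a_{i,k} obey the last passage
   recursion whose weights are the numbers of descents of value k+1 in row i.
   Since the a_{i,k} determine p, this is a bijection between PP(oo,b,c) and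
   b x c matrices of weights, read backwards so that paths start at (b-1,c-1):
   part i of the shape is a_{i,0} = G(b-i,c), and the sum of the weights is the
   number of descents, so i.i.d. geometric weights induce the g-measure, and
   Z = (1-q)^{-bc} because the total probability is 1.  In each column every
   positive value has exactly one descent, at its last occurrence, which
   identifies the g-weight with the monomial of g_la. *)

Set Implicit Arguments.
Unset Strict Implicit.
Unset Printing Implicit Defensive.

Import Order.TTheory GRing.Theory Num.Theory.

Local Open Scope classical_set_scope.
Local Open Scope ring_scope.

(** * Last passage times: path decomposition and recursion *)

Lemma last_passage_leP (w : nat -> nat -> nat) m n N :
  (0 < m)%N -> (0 < n)%N ->
  (last_passage w m n <= N)%N <->
  (forall s, lattice_path m n s -> (\sum_(z <- s) w z.1 z.2 <= N)%N).
Proof.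
move=> m0 n0; split=> [/bigmax_leqP wN s sP|wN]; last first.
  apply/bigmax_leqP => s sP.
  by move: (wN _ sP); rewrite big_map.
have /allP sin := lattice_path_inside m0 n0 sP.
case: m m0 => // m _ in wN sP sin *; case: n n0 => // n _ in wN sP sin *.
(* All vertices of [s] lie in the rectangle, so [inord] loses nothing and [s] is one of the tuples
   in the maximum. *)
pose f (z : nat * nat) : 'I_m.+1 * 'I_n.+1 := (inord z.1, inord z.2).
have fs : size [seq f z | z <- s] == (m.+1 + n.+1).-1.
  by rewrite size_map (lattice_path_size _ _ sP).
have sE : [seq (val z.1, val z.2) | z <- Tuple fs] = s.
  rewrite /= -map_comp -[RHS]map_id; apply/eq_in_map => -[i j] /sin /= /andP[iP jP].
  by rewrite /f /= !inordK.
have := wN (Tuple fs); rewrite sE => /(_ sP); apply: leq_trans.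
rewrite -[X in (\sum_(z <- X) _ <= _)%N]sE big_map.
exact: leqnn.
Qed.

Lemma last_passage_ge w m n s : (0 < m)%N -> (0 < n)%N -> lattice_path m n s ->
  (\sum_(z <- s) w z.1 z.2 <= last_passage w m n)%N.
Proof.
move=> m0 n0.
by have /(last_passage_leP w _ m0 n0) := leqnn (last_passage w m n); apply.
Qed.

(** An empty rectangle carries no path, so the maximum takes its default value 0, the boundary value
    for the recursion below. *)
Lemma last_passage0l w n : last_passage w 0 n = 0%N.
Proof.
rewrite /last_passage big1// => -[[|[[]//]]//= _]; by rewrite big_nil.
Qed.

Lemma last_passage0r w m : last_passage w m 0 = 0%N.
Proof.
rewrite /last_passage big1// => -[[|[_ []//]]//= _]; by rewrite big_nil.
Qed.

Lemma lattice_path_rcons m n m' n' s : lattice_path m n s ->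
  lattice_step (m.-1, n.-1) (m', n') -> lattice_path m'.+1 n'.+1 (rcons s (m', n')).
Proof.
case: s => // u s /and3P[u0 us /eqP sl] st.
by rewrite /lattice_path/= u0 rcons_path us sl st last_rcons/=.
Qed.

Lemma lattice_path_split m n s : lattice_path m.+1 n.+1 s ->
  [/\ m = 0, n = 0 & s = [:: (0, 0)]]%N \/
  exists s', s = rcons s' (m, n) /\
    ((0 < m)%N /\ lattice_path m n.+1 s' \/ (0 < n)%N /\ lattice_path m.+1 n s').
Proof.
case: s => // u s /and3P[/eqP-> + /eqP]; case/lastP: s => [|s v] /=.
  by move=> _ [<- <-]; left.
rewrite rcons_path last_rcons => /andP[us +] vE; rewrite {v}vE => st; right.
exists ((0, 0) :: s)%N; split => //.
case lE: (last _ s) st => [i j] /orP[] /eqP[-> ->]; [left|right];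
  by rewrite /lattice_path /= us lE eqxx.
Qed.

Lemma lattice_path_exists m n : exists s, lattice_path m.+1 n.+1 s.
Proof.
elim: m n => [|m IH] n; last first.
  have [s sP] := IH n; exists (rcons s (m.+1, n)).
  by apply: lattice_path_rcons sP _; rewrite /lattice_step eqxx.
elim: n => [|n [s sP]]; first by exists [:: (0, 0)%N].
exists (rcons s (0, n.+1)%N).
by apply: lattice_path_rcons sP _; rewrite /lattice_step eqxx orbT.
Qed.

(** A path to [(m, n)] is either that single vertex or a path to the neighbour above or to the left,
    extended by one step. The zero boundary values are harmless because times are nonnegative. *)
Lemma last_passageSS w m n : last_passage w m.+1 n.+1 =
  (maxn (last_passage w m n.+1) (last_passage w m.+1 n) + w m n)%N.
Proof.
apply/eqP; rewrite eqn_leq; apply/andP; split.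
  apply/last_passage_leP => // s /lattice_path_split[[-> -> ->]|[s' [-> sP]]].
    by rewrite big_seq1 leq_addl.
  rewrite -cats1 big_cat big_seq1 /= leq_add2r leq_max.
  by case: sP => -[gt0 sP]; rewrite (last_passage_ge w _ _ sP) ?orbT.
(* This bound makes the truncated subtraction below exact, and it settles the cases where a
   neighbour is missing. *)
have le_w : (w m n <= last_passage w m.+1 n.+1)%N.
  have [s sP] := lattice_path_exists m n.
  apply: leq_trans (last_passage_ge w _ _ sP) => //.
  have [[-> -> ->]|[s' [-> _]]] := lattice_path_split sP; first by rewrite big_seq1.
  by rewrite -cats1 big_cat big_seq1 leq_addl.
rewrite addnC -leq_subRL// geq_max; apply/andP; split.
  case: m le_w => [|m] le_w; first by rewrite last_passage0l.
  apply/last_passage_leP => // s sP; rewrite leq_subRL// addnC.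
  have /(last_passage_ge w) : lattice_path m.+2 n.+1 (rcons s (m.+1, n)).
    by apply: lattice_path_rcons sP _; rewrite /lattice_step eqxx.
  by rewrite -cats1 big_cat big_seq1; apply.
case: n le_w => [|n] le_w; first by rewrite last_passage0r.
apply/last_passage_leP => // s sP; rewrite leq_subRL// addnC.
have /(last_passage_ge w) : lattice_path m.+1 n.+2 (rcons s (m, n.+1)).
  by apply: lattice_path_rcons sP _; rewrite /lattice_step eqxx orbT.
by rewrite -cats1 big_cat big_seq1; apply.
Qed.

(** * Numbers as counts of the indices below them *)

Lemma sub_ltn_leq m n : (forall j, j < m -> j < n)%N -> (m <= n)%N.
Proof. by move=> mn; rewrite leqNgt; apply/negP => /mn; rewrite ltnn. Qed.

Lemma eq_ltn_eq m n : (forall j, (j < m) = (j < n))%N -> m = n.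
Proof.
move=> mn; apply/eqP; rewrite eqn_leq.
by apply/andP; split; apply: sub_ltn_leq => j; rewrite mn.
Qed.

Lemma sum_ltn M t : (t <= M)%N -> (\sum_(j < M) (j < t) = t)%N.
Proof.
elim: M t => [|M IH] [|t] tM //; first by rewrite big_ord0.
  by rewrite big1.
by rewrite big_ord_recl/= -[RHS]add1n; congr addn; exact: IH.
Qed.

(* The sum over [l] is the [k]-th part of the conjugate of the partition [f]. *)
Lemma ltn_sum_ltn (f : nat -> nat) M k j :
  (forall l, (f l.+1 <= f l)%N) -> (f M <= k)%N ->
  (j < \sum_(l < M) (k < f l))%N = (k < f j)%N.
Proof.
elim: M f j => [|M IH] f j f_dec fM.
  rewrite big_ord0 ltn0; apply/esym/negbTE; rewrite -leqNgt (leq_trans _ fM)//.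
  by elim: j => // j; exact: leq_trans.
have f_le l : (f l <= f 0)%N by elim: l => // l; exact: leq_trans.
rewrite big_ord_recl /=; set s := (\sum_(l < M) _)%N.
have {}IH i : (i < s)%N = (k < f i.+1)%N := IH (f \o S) i (fun l => f_dec l.+1) fM.
case: j => [|j]; case: (ltnP k (f 0%N)) => [kf|fk]; first by rewrite add1n.
- by rewrite add0n IH ltnNge (leq_trans (f_le _)).
- by rewrite add1n ltnS IH.
- by rewrite add0n IH !ltnNge !(leq_trans (f_le _) fk).
Qed.

Lemma card_set_sum (A : set nat) M : (forall j, A j -> (j < M)%N) ->
  card_set A = (\sum_(j < M) `[< A j >])%N.
Proof.
move=> AM; have fA : finite_set A by apply: sub_finite_set (finite_II M) => j /AM.
rewrite /card_set card_fset_sum1 -fsbig_finite//=.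
rewrite (fsbig_ord _ _ (fun j => `[< A j >] : nat)) -(@fsbig_widen _ _ _ _ A).
- by apply: eq_fsbigr => j; rewrite inE => Aj; rewrite asboolT.
- by move=> j /AM.
- by move=> j /= [_ jA]; rewrite asboolF.
Qed.

(** * Row counts of a plane partition and their recursion *)

Section PlanePartition.
Variable p : nat -> nat -> nat.
Hypothesis pp : plane_partition p.

(** At [k = 0] this is convertible to [pp_shape p i]. *)
Definition row_count i k := card_set [set j | (k < p i j)%N].

Lemma pp_eq0 i j : (pp_shape p 0 <= j)%N -> p i j = 0%N.
Proof.
move=> jM; apply/eqP; rewrite -leqn0 leqNgt; apply: contraL jM => pij.
rewrite -ltnNge; apply: (shape_gt pp); apply: leq_trans pij _.
by have [_ _ pc] := pp; elim: i => // i; apply: leq_trans.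
Qed.

(** Rows decrease, so the columns counted form an initial segment. In particular the row counts
    determine [p]. *)
Lemma ltn_row_count i j k : (j < row_count i k)%N = (k < p i j)%N.
Proof.
have [_ pr _] := pp.
rewrite /row_count (@card_set_sum _ (pp_shape p 0)); last first.
  by move=> l /=; case: (ltnP l (pp_shape p 0)) => // /pp_eq0 ->.
under eq_bigr do rewrite asboolb.
by rewrite ltn_sum_ltn// pp_eq0.
Qed.

Definition descent_count i k :=
  (row_count i k - maxn (row_count i.+1 k) (row_count i k.+1))%N.

Lemma row_count_rec i k : row_count i k =
  (maxn (row_count i.+1 k) (row_count i k.+1) + descent_count i k)%N.
Proof.
have [_ _ pc] := pp.
rewrite subnKC// geq_max; apply/andP; split; apply: sub_ltn_leq => j;
  rewrite !ltn_row_count; first by move/leq_trans; apply.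
exact: ltnW.
Qed.
End PlanePartition.

(** Once the row counts are written as sums of indicators over columns, the recursion can be checked
    in each column separately: an entry exceeding [k] either has its lower neighbour above [k], or
    exceeds [k.+1], or is a descent of value [k.+1]. *)
Lemma descent_count_sum p i k : plane_partition p ->
  descent_count p i k =
  (\sum_(j < pp_shape p 0) ((p i j == k.+1) && (p i.+1 j < p i j)))%N.
Proof.
move=> pp; have [_ _ pc] := pp.
apply/eqP; rewrite -(eqn_add2l (maxn (row_count p i.+1 k) (row_count p i k.+1))).
rewrite -row_count_rec//.
have le_shape i' k' : (row_count p i' k' <= pp_shape p 0)%N.
  apply: sub_ltn_leq => j; rewrite ltn_row_count//.
  by case: (ltnP j (pp_shape p 0)) => // /(pp_eq0 pp i') ->.
rewrite -[X in X == _](sum_ltn (le_shape i k)).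
rewrite -[X in (X + _)%N](@sum_ltn (pp_shape p 0)) ?geq_max ?le_shape//.
rewrite -big_split; apply/eqP/eq_bigr => j _ /=.
rewrite leq_max -!/(_ < _)%N !ltn_row_count//.
by have := pc i j; lia.
Qed.

Lemma row_count_eq0 p b c i k : PP b c p -> (b <= i)%N || (c <= k)%N ->
  row_count p i k = 0%N.
Proof.
move=> [pp pb pc] bc; apply/eqP; rewrite -leqn0; apply: sub_ltn_leq => j.
rewrite ltn_row_count//; case/orP: bc => [bi|ck]; first by rewrite pb.
by rewrite ltnNge (leq_trans (pc _ _)).
Qed.

(** * The bijection between weight matrices and plane partitions *)

Definition pp_of_weights b c (w : nat -> nat -> nat) : nat -> nat -> nat :=
  fun i j => (\sum_(k < c) (j < last_passage w (b - i) (c - k)))%N.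

Section PPOfWeights.
Variables (b c : nat) (w : nat -> nat -> nat).
Let G m n := last_passage w m n.

Lemma last_passage_leS m n : (G m n <= G m.+1 n)%N /\ (G m n <= G m n.+1)%N.
Proof.
rewrite /G; split.
  case: n => [|n]; first by rewrite last_passage0r.
  by rewrite last_passageSS; apply: leq_trans (leq_maxl _ _) (leq_addr _ _).
case: m => [|m]; first by rewrite last_passage0l.
by rewrite last_passageSS; apply: leq_trans (leq_maxr _ _) (leq_addr _ _).
Qed.

(** Last passage times decrease as [k] grows, so row [i] is the conjugate of the partition with
    parts [last_passage w (b - i) (c - k)]. *)
Lemma ltn_pp_of_weights i j k :
  (k < pp_of_weights b c w i j)%N = (j < last_passage w (b - i) (c - k))%N.
Proof.
rewrite /pp_of_weights (@ltn_sum_ltn (fun k => G (b - i) (c - k)))//.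
  move=> l; rewrite subnS; case: (c - l)%N => //= n.
  by have [] := last_passage_leS (b - i) n.
by rewrite subnn /G last_passage0r.
Qed.

Lemma pp_of_weights_PP : PP b c (pp_of_weights b c w).
Proof.
have G_bound i j : (b <= i)%N || (G b c <= j)%N -> pp_of_weights b c w i j = 0%N.
  move=> bij; rewrite /pp_of_weights big1// => k _; apply/eqP; rewrite eqb0 -leqNgt.
  case/orP: bij => [bi|Gj]; first by rewrite (eqP bi) last_passage0l.
  apply: leq_trans Gj; apply: (@leq_trans (G (b - i) c)).
    elim: (val k) => [|l IH]; first by rewrite subn0.
    apply: leq_trans IH; rewrite subnS; case: (c - l)%N => //= n.
    by have [] := last_passage_leS (b - i) n.
  elim: i => [|l IH]; first by rewrite subn0.
  apply: leq_trans IH; rewrite subnS; case: (b - l)%N => //= n.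
  by have [] := last_passage_leS n c.
split; last 2 first.
- by move=> i j bi; rewrite G_bound ?bi.
- move=> i j; apply: leq_trans (leq_sum _ _) _; first by move=> k _; exact: leq_b1.
  by rewrite sum1_card card_ord.
split.
- apply: (@sub_finite_set _ _ (`I_b `*` `I_(G b c))).
    move=> [i j] /= pij; split; rewrite /= ltnNge; apply/negP => le; apply: pij;
    by rewrite G_bound// le ?orbT.
  by apply: finite_setX; exact: finite_II.
- move=> i j; apply: sub_ltn_leq => k; rewrite !ltn_pp_of_weights; exact: ltnW.
- move=> i j; apply: sub_ltn_leq => k; rewrite !ltn_pp_of_weights => /leq_trans; apply.
  by rewrite subnS; case: (b - i)%N => //= n; have [] := last_passage_leS n (c - k).
Qed.

Lemma row_count_pp_of_weights i k :
  row_count (pp_of_weights b c w) i k = last_passage w (b - i) (c - k).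
Proof.
have [pp _ _] := pp_of_weights_PP.
by apply: eq_ltn_eq => j; rewrite ltn_row_count// ltn_pp_of_weights.
Qed.

(** Solving the recursion for its last term recovers each weight in the rectangle from [p]. Weights
    outside the rectangle do not matter. *)
Lemma pp_of_weights_eq p : PP b c p ->
  pp_of_weights b c w = p <->
  (forall m n, (m < b)%N -> (n < c)%N ->
     w m n = descent_count p (b - m.+1) (c - n.+1)).
Proof.
move=> PPp; have [pp pb pc] := PPp; split=> [pE m n mb nc|wE].
  rewrite /descent_count -pE !row_count_pp_of_weights -!subSn// !subSS.
  by have [mb' nc'] := (ltnW mb, ltnW nc); rewrite !subKn// last_passageSS addKn.
(* Both arrays satisfy the same recursion with zero boundary, so they agree by induction on [m] and
   [n]. *)
have GE m n : (m <= b)%N -> (n <= c)%N -> G m n = row_count p (b - m) (c - n).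
  elim: m n => [|m IHm] n mb.
    by rewrite subn0 (row_count_eq0 PPp) ?leqnn // /G last_passage0l.
  elim: n => [|n IHn] nc.
    by rewrite subn0 (row_count_eq0 PPp) ?leqnn ?orbT // /G last_passage0r.
  rewrite row_count_rec// -!subSn// !subSS -wE// -IHm ?(ltnW mb)// -IHn ?(ltnW nc)//.
  by rewrite /G last_passageSS.
apply/funext => i; apply/funext => j.
apply: eq_ltn_eq => k; rewrite ltn_pp_of_weights -/(G _ _).
have [kc|ck] := ltnP k c; last first.
  by rewrite (eqP ck) /G last_passage0r ltn0 ltnNge (leq_trans (pc _ _)).
have [ib|bi] := ltnP i b; last by rewrite (eqP bi) /G last_passage0l pb.
by rewrite GE ?leq_subr// !subKn ?(ltnW ib) ?(ltnW kc)// ltn_row_count.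
Qed.

End PPOfWeights.

(** * The g-weight as a power of [q], and columns containing a value *)

Definition cells m n := [seq (i, j) | i <- index_iota 0 m, j <- index_iota 0 n].

Lemma cells_uniq m n : uniq (cells m n).
Proof. by apply: allpairs_uniq; rewrite ?iota_uniq// => -[? ?] [? ?]. Qed.

Lemma mem_cells m n z : (z \in cells m n) = (z.1 < m)%N && (z.2 < n)%N.
Proof.
apply/allpairsP/idP => [[[i j] /= []]|zmn]; last first.
  by exists z; rewrite !mem_index_iota; case: z zmn => i j /andP[].
by rewrite !mem_index_iota => im jn ->; apply/andP.
Qed.

Lemma big_cells (R : Type) (idx : R) (op : Monoid.law idx) m n
    (F : nat * nat -> R) :
  \big[op/idx]_(z <- cells m n) F z =
  \big[op/idx]_(i < m) \big[op/idx]_(j < n) F (val i, val j).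
Proof.
rewrite big_allpairs big_mkord.
by apply: eq_bigr => i _; rewrite big_mkord.
Qed.

(** Equal values in a decreasing column are consecutive, so only the last occurrence of [v.+1] is a
    descent. It lies before [b] because [f b = 0]. *)
Lemma sum_descent (f : nat -> nat) b v : (forall i, f i.+1 <= f i)%N -> f b = 0%N ->
  (\sum_(i < b) ((f i == v.+1) && (f i.+1 < f i)) = `[< exists i, f i = v.+1 >])%N.
Proof.
elim: b f => [|b IH] f f_dec f0.
  rewrite big_ord0 asboolF// => -[i].
  suff -> : f i = 0%N by [].
  by apply/eqP; rewrite -leqn0 -f0; elim: i => // i; exact: leq_trans.
rewrite big_ord_recl /=.
have -> : (\sum_(i < b) ((f (bump 0 i) == v.+1) && (f (bump 0 i).+1 < f (bump 0 i))))%N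
          = `[< exists i, f i.+1 = v.+1 >] :> nat
  := IH (f \o S) (fun i => f_dec i.+1) f0.
have f1_le i : (f i.+1 <= f 1)%N by elim: i => // i; exact: leq_trans.
case: eqP => [f0v|f0v] /=; last first.
  rewrite add0n; congr nat_of_bool; apply/asbool_equiv_eq.
  by split=> -[[|i]//] fi; [exists 1%N|exists i.+2|exists i].
rewrite [in RHS]asboolT; last by exists 0%N.
(* Either the head is the last occurrence of [v.+1] and the tail stays below it, or the tail starts
   with [v.+1] again and contributes the descent. *)
case: ltnP => f1.
  by rewrite asboolF// => -[i fi]; have := f1_le i; rewrite fi -f0v leqNgt f1.
by rewrite asboolT//; exists 0%N; apply/eqP; rewrite eqn_leq -f0v f1 f_dec.
Qed.

Section Weight.
Variables (b c : nat) (p : nat -> nat -> nat).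
Hypothesis PPp : PP b c p.
Let M := pp_shape p 0.

Lemma sum_descent_count :
  (\sum_(i < b) \sum_(k < c) descent_count p i k =
   \sum_(i < b) \sum_(j < M) (p i.+1 j < p i j))%N.
Proof.
have [pp _ pc] := PPp; apply: eq_bigr => i _.
under eq_bigr do rewrite descent_count_sum//.
rewrite exchange_big; apply: eq_bigr => j _ /=.
have := pc i j; case: (p i j) => [|v] vc.
  by rewrite ltn0 big1// => k _; rewrite andbF.
(* An entry [v.+1] can be counted only at [k = v], which is in range because entries are at most
   [c]. *)
rewrite (bigD1 (Ordinal vc))//= eqxx /= big1 ?addn0// => k.
by rewrite eqSS eq_sym -val_eqE/= => /negbTE ->.
Qed.

Lemma sum_columns_containing :
  (\sum_(1 <= k < c.+1) columns_containing p k =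
   \sum_(i < b) \sum_(k < c) descent_count p i k)%N.
Proof.
have [pp pb _] := PPp; have [_ pr pc] := pp.
rewrite big_add1 /= big_mkord [RHS]exchange_big; apply: eq_bigr => k _.
under [RHS]eq_bigr do rewrite descent_count_sum//.
rewrite exchange_big /columns_containing (@card_set_sum _ M) => [|j [i pij]].
  by apply: eq_bigr => j _; rewrite (sum_descent k (fun i => pc i j)) ?pb.
by case: (ltnP j M) => // /(pp_eq0 pp i); rewrite pij.
Qed.

Lemma g_weightE (R : realType) (q : R) : g_weight (fun=> q) p =
  q ^+ (\sum_(i < b) \sum_(k < c) descent_count p i k)%N.
Proof.
have [pp pb _] := PPp.
pose desc z := (p z.1.+1 z.2 < p z.1 z.2)%N : nat.
rewrite sum_descent_count -(@big_cells _ _ _ b M desc) /desc.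
rewrite expr_sum fsbig_seq ?cells_uniq// -(@fsbig_widen _ _ _ _ (Des p)).
- by apply: eq_fsbigr => z; rewrite inE /Des /= => ->.
- move=> [i j]; rewrite /Des /= mem_cells => pij; apply/andP; split=> /=.
    by case: (ltnP i b) pij => // /pb ->.
  by case: (ltnP j M) pij => // /(pp_eq0 pp i) ->.
- by move=> z /= [_ /negP /negbTE ->].
Qed.
End Weight.

(** * The law of the plane partition built from geometric weights *)

Lemma measure_countable_bigcup d (T : measurableType d) (R : realType)
    (mu : {measure set T -> \bar R}) (I : choiceType) (A : set I) (E : I -> set T) :
  countable A -> (forall i, A i -> measurable (E i)) -> trivIset A E ->
  mu (\bigcup_(i in A) E i) = \esum_(i in A) mu (E i).
Proof.
move=> /countable_injP[f f_inj] mE tE.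
(* Each [F n] collects at most one [E i], which reindexes the family by integers so that
   sigma-additivity applies. *)
pose F n := \bigcup_(i in A `&` f @^-1` [set n]) E i.
have FE i : A i -> F (f i) = E i.
  move=> Ai; rewrite /F (_ : _ `&` _ = [set i]) ?bigcup_set1//.
  apply/seteqP; split=> [j [Aj fj]|j ->] //=.
  by apply: f_inj; rewrite ?inE.
have -> : \bigcup_(i in A) E i = \bigcup_(n in f @` A) F n.
  by rewrite bigcup_image; apply: eq_bigcupr => i Ai; rewrite FE.
rewrite measure_bigcup.
- rewrite nneseries_esum// set_mem_set esum_image => [|i j Ai Aj].
    by apply: eq_esum => i Ai; rewrite FE.
  exact: f_inj.
- by move=> _ [i Ai <-]; rewrite FE//; exact: mE.
- move=> _ _ [i Ai <-] [j Aj <-]; rewrite !FE// => ij; congr f; exact: tE.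
Qed.

Lemma countable_PP b c : countable (PP b c).
Proof.
pose f (p : nat -> nat -> nat) : 'M[nat]_(b, c) := \matrix_(i, k) row_count p i k.
have f_inj : {in PP b c &, injective f}.
  move=> p p' /set_mem PPp /set_mem PPp' /matrixP eq_f.
  have [pp _ _] := PPp; have [pp' _ _] := PPp'.
  apply/funext => i; apply/funext => j; apply: eq_ltn_eq => k.
  rewrite -(ltn_row_count pp) -(ltn_row_count pp'); congr (_ < _)%N.
  have [ib|bi] := ltnP i b; last by rewrite !(@row_count_eq0 _ b c)// bi.
  have [kc|ck] := ltnP k c; last by rewrite !(@row_count_eq0 _ b c)// ck orbT.
  by have := eq_f (Ordinal ib) (Ordinal kc); rewrite !mxE.
apply/countable_injP; exists (fun p => choice.pickle (f p)) => p p' Ap Ap'.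
by move/(pcan_inj choice.pickleK); exact: f_inj.
Qed.

Section GeometricWeights.
Context (R : realType) (d : measure_display) (T : measurableType d).
Variables (P : probability T R) (q : R) (w : nat * nat -> {RV P >-> nat}) (b c : nat).
Hypotheses (q_lt1 : q < 1) (w_indep : mutually_independent w).
Hypothesis w_geom : forall ij (k : nat),
  P (w ij @^-1` [set k]) = ((1 - q) * q ^+ k)%:E.

Let pp_of t := pp_of_weights b c (fun i j => w (i, j) t).

(** The event becomes a finite intersection of conditions on single weights, the form required by
    independence. *)
Lemma pp_of_preimage p : PP b c p ->
  pp_of @^-1` [set p] = \bigcap_(z in [set` cells b c])
    w z @^-1` [set descent_count p (b - z.1.+1) (c - z.2.+1)].
Proof.
move=> PPp; apply/seteqP; split=> t /=.
  move/(pp_of_weights_eq _ PPp) => wE [i j]; rewrite /= mem_cells => /andP[ib jc].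
  exact: wE.
move=> wE; apply/(pp_of_weights_eq _ PPp) => i j ib jc.
by apply: (wE (i, j)); rewrite /= mem_cells ib.
Qed.

Lemma measurable_pp_of p : PP b c p -> measurable (pp_of @^-1` [set p]).
Proof.
move=> PPp; rewrite pp_of_preimage//; apply: fin_bigcap_measurable => // z _.
by rewrite -[_ @^-1` _]setTI; exact: measurable_funP.
Qed.

Lemma pp_of_prob p : PP b c p ->
  P (pp_of @^-1` [set p]) = ((1 - q) ^+ (b * c) * g_weight (fun=> q) p)%:E.
Proof.
move=> PPp; rewrite pp_of_preimage// (g_weightE PPp).
have Jcells : [set` [fset z | z in cells b c]%fset] = [set` cells b c].
  by apply/seteqP; split => z /=; rewrite in_fset.
rewrite -Jcells w_indep; last by [].
rewrite (perm_big (cells b c)) /=; last first.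
  by apply: uniq_perm; rewrite ?cells_uniq ?fset_uniq// => z; rewrite in_fset.
under eq_bigr do rewrite w_geom.
rewrite prodEFin big_split !big_cells /=; congr (_ * _)%:E.
  under eq_bigr do rewrite prodr_const card_ord.
  by rewrite prodr_const card_ord -exprM mulnC.
(* Cell [(i, j)] carries the descent count at [(b - i.+1, c - j.+1)], so both products are
   reversed. *)
rewrite expr_sum [RHS](reindex_inj rev_ord_inj) /=; apply: eq_bigr => i _.
by rewrite expr_sum [RHS](reindex_inj rev_ord_inj).
Qed.

Lemma pp_of_PP t : PP b c (pp_of t).
Proof. exact: pp_of_weights_PP. Qed.

(* The factor [r] makes the case [A = setT], [r = (1-q)^{-bc}] compute [g_Z]. *)
Lemma scaled_pp_of_prob (r : {nonneg R}) (A : set (nat -> nat -> nat)) :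
  (r%:num%:E * P (pp_of @^-1` A) =
  \esum_(p in PP b c `&` A)
    (r%:num * ((1 - q) ^+ (b * c) * g_weight (fun=> q) p))%:E)%E.
Proof.
have -> : pp_of @^-1` A = \bigcup_(p in PP b c `&` A) pp_of @^-1` [set p].
  apply/seteqP; split=> [t At|t [p [_ Ap] /= tp]].
    by exists (pp_of t) => //; split=> //; exact: pp_of_PP.
  by rewrite /preimage /= tp.
(* Scaling by [r] gives again a measure, so the factor enters the sum by countable additivity. *)
rewrite -[LHS]/(mscale r P _) measure_countable_bigcup.
- apply: eq_esum => p [PPp _].
  exact: (congr1 (fun x => r%:num%:E * x)%E (pp_of_prob PPp)).
- by apply: sub_countable (countable_PP b c); apply: subset_card_le => p [].
- by move=> p [PPp _]; exact: measurable_pp_of.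
- by move=> p p' _ _ [t [/= -> ->]].
Qed.

Let K_gt0 : 0 < (1 - q) ^+ (b * c).
Proof. by rewrite exprn_gt0// subr_gt0. Qed.

Lemma g_Z_geometric : g_Z (fun=> q) b c = ((1 - q) ^- (b * c))%:E.
Proof.
have K_inv : 0 <= (1 - q) ^- (b * c) by rewrite invr_ge0 ltW.
have := scaled_pp_of_prob (NngNum K_inv) setT.
rewrite preimage_setT probability_setT mule1 setIT /= => ->.
by apply: eq_esum => p _; rewrite mulKf ?gt_eqF.
Qed.

Lemma g_massE p : g_mass (fun=> q) b c p = (1 - q) ^+ (b * c) * g_weight (fun=> q) p.
Proof. by rewrite /g_mass g_Z_geometric /= invrK. Qed.

Lemma g_probE A : g_prob (fun=> q) b c A = P (pp_of @^-1` A).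
Proof.
rewrite -[RHS]mul1e (scaled_pp_of_prob 1%:nng); apply: eq_esum => p _.
by rewrite g_massE mul1r.
Qed.

End GeometricWeights.

(** * Shapes and the dual Grothendieck polynomial *)

Section Shape.
Variables (b c : nat) (la : nat -> nat).
Hypothesis la_part : partition_at_most b la.

Lemma PP_shape : PP b c `&` [set p | pp_shape p = la] = pp_shape_entries la c.
Proof.
have [_ lab] := la_part.
apply/seteqP; split=> p /=; first by move=> [[pp _ pc] pla].
move=> [pp pla pc]; split=> //; split=> // i j bi.
apply/eqP; rewrite -leqn0 leqNgt; apply/negP => /(shape_gt pp).
by rewrite pla lab.
Qed.

(** Part [i] of the shape is the row count at [k = 0]. From row [b] on both sides vanish, so only
    [i < b] remains. *)
Lemma pp_of_weights_shape w : pp_shape (pp_of_weights b c w) = la <->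
  (forall i, (i < b)%N -> last_passage w (b - i) c = la i).
Proof.
have [_ lab] := la_part.
have shapeE i : pp_shape (pp_of_weights b c w) i = last_passage w (b - i) c.
  by rewrite -[LHS]/(row_count _ i 0) row_count_pp_of_weights subn0.
split=> [<- //|laE]; apply/funext => i; rewrite shapeE.
by have [/laE //|bi] := ltnP i b; rewrite (eqP bi) last_passage0l lab.
Qed.

Lemma dual_grothendieck_const (R : realType) (q : R) :
  dual_grothendieck la c (fun=> q) =
  \sum_(p \in pp_shape_entries la c) g_weight (fun=> q) p.
Proof.
apply: eq_fsbigr => p; rewrite -PP_shape inE => -[PPp _].
by rewrite (g_weightE PPp) -(sum_columns_containing PPp) expr_sum.
Qed.

End Shape.

Theorem theorem8p1 (R : realType) (d : measure_display) (T : measurableType d)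
    (P : probability T R) (q : R) (w : nat * nat -> {RV P >-> nat})
    (b c : nat) (la : nat -> nat)
    (q_gt0 : 0 < q) (q_lt1 : q < 1)
    (w_indep : mutually_independent w)
    (w_geom : forall ij (k : nat),
       P (w ij @^-1` [set k]) = ((1 - q) * q ^+ k)%:E)
    (b_gt0 : (0 < b)%N) (c_gt0 : (0 < c)%N)
    (la_part : partition_at_most b la) :
  P [set t | forall i, (i < b)%N ->
       last_passage (fun i j => w (i, j) t) (b - i) c = la i]
    = g_prob (fun=> q) b c [set p | pp_shape p = la] /\
  g_prob (fun=> q) b c [set p | pp_shape p = la]
    = ((1 - q) ^+ (b * c) * dual_grothendieck la c (fun=> q))%:E.
Proof.
split.
  rewrite (g_probE _ _ q_lt1 w_indep w_geom); congr (P _).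
  by apply/seteqP; split=> t /=; rewrite pp_of_weights_shape.
have fin := finite_pp_shape_entries la c.
rewrite /g_prob PP_shape// esum_fset//.
  under eq_fsbigr do rewrite (g_massE _ _ q_lt1 w_indep w_geom).
  by rewrite fsumEFin// -mulr_fsumr (dual_grothendieck_const c la_part).
(* Nonnegativity of the masses, required to replace the extended sum by a finite one. *)
move=> p; rewrite inE -(PP_shape c la_part) => -[PPp _].
rewrite (g_massE _ _ q_lt1 w_indep w_geom) lee_fin (g_weightE PPp).
by rewrite mulr_ge0// exprn_ge0 ?subr_ge0// ltW.
Qed.
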